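(* Let $G$ be a block graph of order $p$ and diameter $d(G)\ge 2$. Then $G$ is a lower bound block graph if and only if there exists an ordering $\vec u=(u_0,u_1,\ldots,u_{p-1})$ of $V(G)$ such that $L(u_0)+L(u_{p-1})=\varepsilon(G)$ and the following is true for all $0\le i<j\le p-1$: $$d(u_i,u_j)\ \ge\ \sum_{t=i}^{j-1}\bigl[L(u_t)+L(u_{t+1})\bigr]-(j-i)\bigl(d(G)+\varepsilon(G)\bigr)+d(G)+1.$$
   Context: Graphs are finite and simple. For a connected graph $G$, $d(u,v)$ is the distance and $d(G)$ the diameter. A radio labeling of $G$ is a map $f:V(G)\to\{0,1,2,\ldots\}$ with $|f(u)-f(v)|\ge d(G)+1-d(u,v)$ for all distinct $u,v$. Its span is $\max\{|f(u)-f(v)|:u,v\in V(G)\}$, and $rn(G)$ is the minimum span of a radio labeling of $G$. A block is a maximal connected induced subgraph without cut-vertices (of itself). A block graph is a connected graph all of whose blocks are complete graphs. The weight at $v$ is $wt(v)=\sum_{u\in V(G)}d(u,v)$, and $W(G)$ is the set of vertices of minimum weight (weight centers). If $|W(G)|\ge2$, then $W(G)$ is contained in a (unique) block, called the central block. The central vertices of $G$ are: the unique weight center if $|W(G)|=1$; all vertices of the central block if $|W(G)|\ge 2$. The level of $v$ is $L(v)=\min\{d(v,w): w \text{ a central vertex}\}$ and $L(G)=\sum_{v\in V(G)}L(v)$. Set $\varepsilon(G)=1$ if $|W(G)|=1$ and $\varepsilon(G)=0$ if $|W(G)|\ge2$. For a block graph $G$ of order $p$ put $LB(G)=(p-1)(d(G)+\varepsilon(G))-2L(G)+\varepsilon(G)$;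 $G$ is called a lower bound block graph if $rn(G)=LB(G)$. *)

(* Defs.v *)
From mathcomp Require Import all_boot all_order all_algebra.
From mathcomp Require Import boolp.

Set Implicit Arguments.
Unset Strict Implicit.
Unset Printing Implicit Defensive.

Section RadioLabeling.

(* A finite simple graph is a symmetric irreflexive relation e on a finType;
   these two properties are assumed in the theorem, not here. *)
Variables (T : finType) (e : rel T).

Definition walk (n : nat) (x y : T) : bool :=
  [exists p : n.-tuple T, path e x p && (last x p == y)].

(* A shortest walk has length < #|T|, so the bound on n is harmless; the default
   #|T| is only returned for vertices in different components. *)
Definition dist (x y : T) : nat :=
  \big[minn/#|T|]_(n < #|T| | walk n x y) n.

Definition diam : nat := \max_(x : T) \max_(y : T) dist x y.

Definition radio_labeling (f : T -> nat) : Prop :=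
  forall u v : T, u != v -> diam + 1 - dist u v <= `|f u - f v|%N.

Definition span (f : T -> nat) : nat :=
  \max_(u : T) \max_(v : T) `|f u - f v|%N.

Definition radio_span (k : nat) : Prop :=
  exists2 f : T -> nat, radio_labeling f & span f = k.

Lemma radio_span_exists : exists k : nat, `[< radio_span k >].
Proof.
pose f (v : T) := enum_rank v * (diam + 1).
exists (span f); apply/asboolP; exists f => // u v uv.
apply: leq_trans (leq_subr _ _) _.
have ne : (enum_rank u : nat) != enum_rank v.
  by apply: contra uv => /eqP/val_inj/enum_rank_inj ->.
have [le_uv|/ltnW le_vu] := leqP (enum_rank u) (enum_rank v).
- rewrite /f distnEr ?leq_mul2r ?le_uv ?orbT // -mulnBl leq_pmull //.
  by rewrite subn_gt0 ltn_neqAle ne.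
- rewrite /f distnEl ?leq_mul2r ?le_vu ?orbT // -mulnBl leq_pmull //.
  by rewrite subn_gt0 ltn_neqAle eq_sym ne.
Qed.

Definition radio_number : nat := ex_minn radio_span_exists.

Definition induced (A : {set T}) : rel T :=
  [rel x y | [&& x \in A, y \in A & e x y]].

Definition connected_in (A : {set T}) : bool :=
  [forall x in A, forall y in A, connect (induced A) x y].

(* The usual notion when A is connected, the only case used below.  The empty set
   counts as connected here, so the vertex of a singleton is not a cut-vertex. *)
Definition cut_vertex (A : {set T}) (v : T) : bool :=
  (v \in A) && ~~ connected_in (A :\ v).

Definition nonseparable (A : {set T}) : bool :=
  [&& A != set0, connected_in A & [forall v, ~~ cut_vertex A v]].

(* Induced subgraphs are represented by their vertex sets. *)
Definition block (B : {set T}) : bool := maxset nonseparable B.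

Definition complete_in (A : {set T}) : Prop :=
  {in A &, forall x y, x != y -> e x y}.

Definition block_graph : Prop :=
  connected_in setT /\ forall B : {set T}, block B -> complete_in B.

Definition wt (v : T) : nat := \sum_(u : T) dist u v.

Definition weight_centers : {set T} := [set v | [forall w, wt v <= wt w]].

(* In a block graph with at least two weight centers, exactly one block contains
   all of them, so the choice made by pick is immaterial. *)
Definition central_block : {set T} :=
  odflt set0 [pick B | block B && (weight_centers \subset B)].

Definition central_vertices : {set T} :=
  if #|weight_centers| == 1 then weight_centers else central_block.

(* The default #|T| exceeds every distance in a connected graph. *)
Definition level (v : T) : nat :=
  \big[minn/#|T|]_(w in central_vertices) dist v w.

Definition total_level : nat := \sum_(v : T) level v.

Definition eps : nat := if #|weight_centers| == 1 then 1 else 0.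

(* Stated in int so that the subtractions are not truncated. *)
Definition LB : int :=
  ((#|T|%:Z - 1) * (diam%:Z + eps%:Z) - 2 * total_level%:Z + eps%:Z)%R.

Definition lower_bound_block_graph : Prop :=
  block_graph /\ radio_number%:Z%R = LB.

(* u 0, ..., u (#|T| - 1) lists every vertex exactly once; the other values of u
   are irrelevant. *)
Definition ordering (u : nat -> T) : bool := perm_eq (mkseq u #|T|) (enum T).

End RadioLabeling.

(* Main.v *)
Require Import Defs.
From mathcomp Require Import all_boot all_order all_algebra.
From mathcomp Require Import boolp zify.

(** Sort the vertices as u_0, ..., u_(p-1) by their labels under a radio
    labeling f.  Two consecutive labels differ by at least
    d(G) + 1 - d(u_t, u_(t+1)), and a path through the central vertices gives
    d(u_t, u_(t+1)) <= L(u_t) + L(u_(t+1)) + 1 - eps ([dist_le_levels]): the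
    central vertices are pairwise adjacent, and there is only one of them when
    eps = 1.  So the labels grow at step t by at least
      [gap u t] = d(G) + eps - L(u_t) - L(u_(t+1)).
    In the sum of all gaps each level is counted twice, except the first and the
    last one, so the sum is LB(G) + L(u_0) + L(u_(p-1)) - eps ([sum_gap_all]).
    When eps = 1 only one vertex has level 0, hence L(u_0) + L(u_(p-1)) >= eps
    and every span is at least LB(G) ([LB_le_span]).

    If the span is LB(G), there is no room left: the end levels add up to eps,
    and the labels of u_i and u_j differ by exactly the sum of the gaps between
    them.  The inequality of the theorem is then the radio condition for u_i and
    u_j.  Conversely, for an ordering as in the theorem the partial sums of the
    gaps are a labeling; the inequality makes it increasing and is its radio
    condition, and its span is the sum of all gaps, which is LB(G). *)

Set Implicit Arguments.
Unset Strict Implicit.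
Unset Printing Implicit Defensive.

Import Order.TTheory GRing.Theory Num.Theory.

(** * Minima with a default value *)

Section BigMinn.

Variables (I : finType) (P : pred I) (F : I -> nat) (m : nat).

Lemma bigminn_le_default : \big[minn/m]_(i | P i) F i <= m.
Proof.
rewrite unlock; elim: (index_enum I) => //= i s IHs.
by case: ifP => // _; rewrite geq_min IHs orbT.
Qed.

Lemma bigminn_le i : P i -> \big[minn/m]_(j | P j) F j <= F i.
Proof.
rewrite unlock /index_enum; have: i \in Finite.enum I by rewrite -enumT mem_enum.
elim: (Finite.enum I) => //= j s IHs; rewrite inE => /orP[/eqP<- ->|].
  exact: geq_minl.
by move=> /IHs le_s /le_s le_i; case: ifP => // _; rewrite geq_min le_i orbT.
Qed.

Lemma bigminn_attained :
  \big[minn/m]_(i | P i) F i = m \/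
  exists2 i, P i & \big[minn/m]_(i | P i) F i = F i.
Proof.
elim/big_ind: _ => [|x y xP yP|i Pi]; first by left.
- by rewrite /minn; case: ifP.
- by right; exists i.
Qed.

End BigMinn.

(** * Distance *)

Section Distance.

Variables (T : finType) (e : rel T).

Lemma walkP n x y :
  reflect (exists2 p, size p = n & path e x p && (last x p == y))
          (walk e n x y).
Proof.
apply: (iffP existsP) => [[p pP]|[p sp pP]].
  by exists p; rewrite ?size_tuple.
by move/eqP: sp => sp; exists (Tuple sp).
Qed.

Lemma dist_le_card x y : dist e x y <= #|T|.
Proof. exact: bigminn_le_default. Qed.

Lemma dist_le_walk n x y : walk e n x y -> dist e x y <= n.
Proof.
move=> wn; case: (ltnP n #|T|) => [ltn|]; last exact: leq_trans (dist_le_card _ _).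
exact: (@bigminn_le _ (fun k : 'I_ #|T| => walk e k x y) _ _ (Ordinal ltn)).
Qed.

Lemma dist_attained x y : dist e x y = #|T| \/ walk e (dist e x y) x y.
Proof.
rewrite /dist; have [->|[i wi ->]] := bigminn_attained
  (fun k : 'I_ #|T| => walk e k x y) (fun k : 'I_ #|T| => k : nat) #|T|.
  by left.
by right.
Qed.

Lemma distxx x : dist e x x = 0.
Proof.
by apply/eqP; rewrite -leqn0; apply/dist_le_walk/walkP; exists [::] => //=.
Qed.

Lemma dist_eq0 x y : dist e x y = 0 -> x = y.
Proof.
have [->|/[swap] ->] := dist_attained x y.
  by move=> c0; have /card0_eq/(_ x) := c0; rewrite inE.
by case/walkP => -[] //= _ /eqP.
Qed.

Lemma dist_edge x y : e x y -> dist e x y <= 1.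
Proof.
by move=> exy; apply/dist_le_walk/walkP; exists [:: y]; rewrite //= exy eqxx.
Qed.

Lemma dist_triangle x y z : dist e x z <= dist e x y + dist e y z.
Proof.
have [->|/walkP[p sp /andP[pp /eqP lp]]] := dist_attained x y.
  exact: leq_trans (dist_le_card _ _) (leq_addr _ _).
have [->|/walkP[q sq /andP[pq lq]]] := dist_attained y z.
  exact: leq_trans (dist_le_card _ _) (leq_addl _ _).
apply/dist_le_walk/walkP; exists (p ++ q); first by rewrite size_cat sp sq.
by rewrite cat_path last_cat lp pp pq.
Qed.

Lemma dist_le_diam x y : dist e x y <= diam e.
Proof.
apply: leq_trans (leq_bigmax x).
exact: (leq_bigmax y (F := fun y => dist e x y)).
Qed.

Lemma diam_gt0_card : 0 < diam e -> 1 < #|T|.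
Proof.
apply: contraTT; rewrite -leqNgt => /card_le1_eqP T1.
rewrite -leqNgt; apply/bigmax_leqP => x _; apply/bigmax_leqP => y _.
by rewrite (T1 x y) ?distxx.
Qed.

Hypothesis e_sym : symmetric e.

Lemma dist_sym x y : dist e x y = dist e y x.
Proof.
suff le_d a b : dist e a b <= dist e b a by apply/eqP; rewrite eqn_leq !le_d.
have [->|/walkP[p <- /andP[pp /eqP <-]]] := dist_attained b a.
  exact: dist_le_card.
apply/dist_le_walk/walkP; exists (rev (belast b p)).
  by rewrite size_rev size_belast.
rewrite (eq_path (e' := fun z => e^~ z)) ?rev_path ?pp //=.
by case: p {pp} => //= c p; rewrite rev_cons last_rcons.
Qed.

End Distance.

(** * Levels *)

Section Levels.

Variables (T : finType) (e : rel T).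

Lemma central_vertices_complete :
  (forall B : {set T}, block e B -> complete_in e B) ->
  complete_in e (central_vertices e).
Proof.
move=> blkK x y; rewrite /central_vertices.
case: ifP => [/cards1P[c ->]|_].
  by rewrite !inE => /eqP-> /eqP->; rewrite eqxx.
rewrite /central_block; case: pickP => [B /andP[/blkK KB _]|_] /=.
  exact: KB.
by rewrite inE.
Qed.

(** With a single central vertex this is the triangle inequality.  Otherwise the
    central vertices nearest to x and y are equal or adjacent, which costs one
    more step.  A level that takes the default value #|T| is at least every
    distance, so that case obeys the same bound. *)
Lemma dist_le_levels x y :
  symmetric e -> block_graph e ->
  dist e x y <= level e x + level e y + (1 - eps e).
Proof.
move=> e_sym [_ /central_vertices_complete KC].
have nearest z : level e z = #|T| \/
    exists2 c, c \in central_vertices e & level e z = dist e z c.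
  exact: bigminn_attained.
have dxy := dist_le_card e x y.
have [->|[a Ca ->]] := nearest x; first by lia.
have [->|[b Cb ->]] := nearest y; first by lia.
have dab : dist e a b <= 1 - eps e.
  have [<-|neq_ab] := eqVneq a b; first by rewrite distxx.
  have dab := dist_edge (KC a b Ca Cb neq_ab); move: Ca Cb neq_ab.
  rewrite /central_vertices /eps; case: ifP => [/cards1P[c ->]|//].
  by rewrite !inE => /eqP-> /eqP->; rewrite eqxx.
have := dist_triangle e x a y; have := dist_triangle e a b y.
by rewrite (dist_sym e_sym b y); lia.
Qed.

Lemma level_eq0 x : level e x = 0 -> x \in central_vertices e.
Proof.
rewrite /level; have [->|[c Cc ->]] := bigminn_attained
  (mem (central_vertices e)) (dist e x) #|T|.
  by move=> /card0_eq/(_ x); rewrite inE.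
by move/dist_eq0->.
Qed.

(** When there is a single central vertex, no other vertex has level 0. *)
Lemma eps_le_levels x y : x != y -> eps e <= level e x + level e y.
Proof.
move=> neq_xy; rewrite /eps; case: ifP => // W1.
rewrite lt0n addn_eq0; apply: contraNN neq_xy => /andP[/eqP/level_eq0 + /eqP/level_eq0].
rewrite /central_vertices W1; have /cards1P[c ->] := W1.
by rewrite !inE => /eqP-> /eqP->.
Qed.

End Levels.

(** * Spans *)

Section Spans.

Variables (T : finType) (e : rel T).

Lemma distn_le_span (f : T -> nat) x y : `|f x - f y|%N <= Defs.span f.
Proof.
apply: leq_trans (leq_bigmax x).
exact: (leq_bigmax y (F := fun y => `|f x - f y|%N)).
Qed.

Lemma radio_number_le_span (f : T -> nat) :
  radio_labeling e f -> radio_number e <= Defs.span f.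
Proof.
move=> rf; rewrite /radio_number; case: ex_minnP => k _; apply.
by apply/asboolP; exists f.
Qed.

Lemma radio_number_attained :
  exists2 f : T -> nat, radio_labeling e f & Defs.span f = radio_number e.
Proof. by rewrite /radio_number; case: ex_minnP => k /asboolP. Qed.

End Spans.

(** * Orderings of the vertices *)

Section Orderings.

Variable T : finType.

Lemma ordering_inj (u : nat -> T) i j :
  ordering u -> i < #|T| -> j < #|T| -> u i = u j -> i = j.
Proof.
move=> ou i_lt j_lt eq_u; have x0 := u 0.
have uq : uniq (mkseq u #|T|) by rewrite (perm_uniq ou) enum_uniq.
apply/eqP; rewrite -(nth_uniq x0 _ _ uq) ?size_mkseq //.
by rewrite !nth_mkseq // eq_u.
Qed.

Lemma ordering_surj (u : nat -> T) v :
  ordering u -> exists2 i, i < #|T| & u i = v.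
Proof.
move=> ou; have: v \in mkseq u #|T| by rewrite (perm_mem ou) mem_enum.
by case/mapP => i; rewrite mem_iota => ? ->; exists i.
Qed.

Lemma ordering_ends_neq (u : nat -> T) :
  ordering u -> 1 < #|T| -> u 0 != u #|T|.-1.
Proof. by move=> ou T_gt1; apply/eqP => /(ordering_inj ou); lia. Qed.

Lemma sorted_ordering (f : T -> nat) : 0 < #|T| ->
  exists2 u, ordering u &
    forall i j, i <= j -> j < #|T| -> f (u i) <= f (u j).
Proof.
case/card_gt0P => x0 _; pose s := sort (relpre f leq) (enum T).
have size_s : size s = #|T| by rewrite size_sort cardE.
exists (nth x0 s); first by rewrite /ordering -size_s mkseq_nth perm_sort.
move=> i j le_ij lt_j; have s_sorted : sorted (relpre f leq) s.
  by apply: sort_sorted => x y; apply: leq_total.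
have leqf_trans : transitive (relpre f leq) by move=> x y z; apply: leq_trans.
have leqf_refl : reflexive (relpre f leq) by move=> x; apply: leqnn.
apply: (sorted_leq_nth leqf_trans leqf_refl x0 s_sorted); rewrite ?inE ?size_s //.
exact: leq_ltn_trans lt_j.
Qed.

End Orderings.

(** * The gap bound *)

Section Gaps.

Variables (T : finType) (e : rel T).
Implicit Type u : nat -> T.

Local Open Scope ring_scope.

Definition gap u (t : nat) : int :=
  (diam e)%:Z + (eps e)%:Z - ((level e (u t))%:Z + (level e (u t.+1))%:Z).

Lemma sum_gap u (i j : nat) : (i <= j)%N ->
  \sum_(i <= t < j) gap u t = (j%:Z - i%:Z) * ((diam e)%:Z + (eps e)%:Z)
    - \sum_(i <= t < j) ((level e (u t))%:Z + (level e (u t.+1))%:Z).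
Proof.
move=> le_ij; rewrite sumrB sumr_const_nat; congr (_ - _).
by rewrite -mulr_natl natz -subzn.
Qed.

(** Each level occurs in two consecutive gaps, except those of the two ends. *)
Lemma sum_gap_all u : ordering u -> (0 < #|T|)%N ->
  \sum_(0 <= t < #|T|.-1) gap u t =
  LB e + (level e (u 0%N))%:Z + (level e (u #|T|.-1))%:Z - (eps e)%:Z.
Proof.
move=> ou T_gt0; rewrite sum_gap // big_split /=.
have: (total_level e = \sum_(0 <= t < #|T|) level e (u t))%N.
  by rewrite /total_level -big_enum -(perm_big _ ou) big_map /index_iota subn0.
rewrite /LB; case: #|T| T_gt0 => //= p _.
rewrite -!(big_morph Posz PoszD (erefl 0)) => total.
have first_out := total; rewrite big_nat_recl // in first_out.
by have last_out := total; rewrite big_nat_recr //= in last_out; lia.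
Qed.

(** Read as a lower bound for a sum of gaps, the inequality of the theorem is
    the radio condition for labels that grow by the gaps. *)
Lemma dist_ge_gap u (i j : nat) : (i <= j)%N ->
  ((dist e (u i) (u j))%:Z >=
     \sum_(i <= t < j) ((level e (u t))%:Z + (level e (u t.+1))%:Z)
     - (j%:Z - i%:Z) * ((diam e)%:Z + (eps e)%:Z) + (diam e)%:Z + 1) =
  ((diam e)%:Z + 1 - (dist e (u i) (u j))%:Z <= \sum_(i <= t < j) gap u t).
Proof. by move=> /sum_gap->; lia. Qed.

Lemma sum_gap_cat u (i j k : nat) : (i <= j)%N -> (j <= k)%N ->
  \sum_(i <= t < k) gap u t =
  \sum_(i <= t < j) gap u t + \sum_(j <= t < k) gap u t.
Proof. exact: big_cat_nat. Qed.

Hypotheses (e_sym : symmetric e) (e_block : block_graph e).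

Lemma sum_gap_le_label (f : T -> nat) u (i j : nat) :
  radio_labeling e f -> ordering u ->
  (forall t k, t <= k -> k < #|T| -> f (u t) <= f (u k))%N ->
  (i <= j)%N -> (j < #|T|)%N ->
  \sum_(i <= t < j) gap u t <= (f (u j))%:Z - (f (u i))%:Z.
Proof.
move=> rf ou f_mono; elim: j => [|j IHj].
  by rewrite leqn0 => /eqP-> _; rewrite big_geq //; lia.
rewrite leq_eqVlt => /orP[/eqP-> _|]; first by rewrite big_geq //; lia.
rewrite ltnS => le_ij j_lt; rewrite (sum_gap_cat u le_ij (leqnSn j)) big_nat1.
have := IHj le_ij (ltnW j_lt); have := f_mono _ _ (leqnSn j) j_lt.
have neq_u : u j != u j.+1.
  by apply/eqP => /(ordering_inj ou (ltnW j_lt) j_lt); lia.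
have := dist_le_levels (u j) (u j.+1) e_sym e_block.
have := rf _ _ neq_u.
have: (eps e <= 1)%N by rewrite /eps; case: ifP.
by rewrite [gap u j]/gap; lia.
Qed.

(** The sum of all gaps is LB(G) plus the excess of the two end levels over
    eps, which is nonnegative because the ends are distinct. *)
Lemma LB_le_span (f : T -> nat) : (1 < #|T|)%N ->
  radio_labeling e f -> LB e <= (Defs.span f)%:Z.
Proof.
move=> T_gt1 rf; have T_gt0 := ltnW T_gt1.
have [u ou f_mono] := sorted_ordering f T_gt0.
have last_lt : (#|T|.-1 < #|T|)%N by rewrite prednK.
have := sum_gap_le_label rf ou f_mono (leq0n _) last_lt.
rewrite sum_gap_all //.
have := eps_le_levels e (ordering_ends_neq ou T_gt1);
  have := distn_le_span f (u 0%N) (u #|T|.-1).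
by lia.
Qed.

(** Sort the vertices by label.  The growth of f over the whole ordering is at
    most LB(G), hence at most the sum of all gaps.  Before i and after j it is
    at least the sum of the gaps there, so between i and j it is at most the sum
    of the gaps in between. *)
Lemma tight_labeling_ordering (f : T -> nat) : (1 < #|T|)%N ->
  radio_labeling e f -> (Defs.span f)%:Z = LB e ->
  exists u : nat -> T,
    [/\ ordering u, (level e (u 0) + level e (u #|T|.-1) = eps e)%N
      & forall i j : nat, (i < j)%N -> (j <= #|T|.-1)%N ->
        (diam e)%:Z + 1 - (dist e (u i) (u j))%:Z <= \sum_(i <= t < j) gap u t].
Proof.
move=> T_gt1 rf span_f; have T_gt0 := ltnW T_gt1.
have [u ou f_mono] := sorted_ordering f T_gt0.
have last_lt : (#|T|.-1 < #|T|)%N by rewrite prednK.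
have growth i j := @sum_gap_le_label f u i j rf ou f_mono.
have total := sum_gap_all ou T_gt0.
have le_span := distn_le_span f (u 0%N) (u #|T|.-1).
have le_levels := eps_le_levels e (ordering_ends_neq ou T_gt1).
exists u; split=> // [|i j lt_ij le_j].
  by have := growth _ _ (leq0n _) last_lt; lia.
have lt_j : (j < #|T|)%N by lia.
have lt_i : (i < #|T|)%N by lia.
have neq_ij : u i != u j by apply/eqP => /(ordering_inj ou lt_i lt_j); lia.
have := growth _ _ (leq0n _) lt_i; have := growth _ _ (ltnW lt_ij) lt_j.
have := growth _ _ le_j last_lt; have := rf _ _ neq_ij.
move: total; rewrite (sum_gap_cat u (leq0n j) le_j).
rewrite (sum_gap_cat u (leq0n i) (ltnW lt_ij)).
by have := f_mono _ _ (ltnW lt_ij) lt_j; lia.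
Qed.

(** The labeling gives u_i the sum of the gaps before i.  These sums increase
    with i because d(G) + 1 - d(u_i, u_j) is positive; so they are nonnegative,
    and the largest of them, the sum of all gaps, bounds the span. *)
Lemma ordering_tight_labeling u : (0 < #|T|)%N -> ordering u ->
  (level e (u 0) + level e (u #|T|.-1) = eps e)%N ->
  (forall i j : nat, (i < j)%N -> (j <= #|T|.-1)%N ->
     (diam e)%:Z + 1 - (dist e (u i) (u j))%:Z <= \sum_(i <= t < j) gap u t) ->
  exists2 f : T -> nat, radio_labeling e f & (Defs.span f)%:Z <= LB e.
Proof.
move=> T_gt0 ou ends far; pose s i := \sum_(0 <= t < i) gap u t.
have s_far i j : (i < j)%N -> (j <= #|T|.-1)%N ->
    (diam e)%:Z + 1 - (dist e (u i) (u j))%:Z <= s j - s i.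
  move=> lt_ij le_j; have := far _ _ lt_ij le_j.
  by rewrite /s (sum_gap_cat u (leq0n i) (ltnW lt_ij)); lia.
have s_mono i j : (i <= j)%N -> (j <= #|T|.-1)%N -> s i <= s j.
  rewrite leq_eqVlt => /orP[/eqP-> //|lt_ij le_j].
  by have := s_far _ _ lt_ij le_j; have := dist_le_diam e (u i) (u j); lia.
have s0 : s 0%N = 0 by rewrite /s big_geq.
have s_last : s #|T|.-1 = LB e by rewrite /s sum_gap_all //; lia.
pose f v := `|s (index v (mkseq u #|T|))|%N.
have fE i : (i <= #|T|.-1)%N -> (f (u i))%:Z = s i.
  move=> le_i; have lt_i : (i < #|T|)%N by lia.
  have := s_mono _ _ (leq0n i) le_i; rewrite s0.
  rewrite /f -(nth_mkseq (u 0%N) u lt_i) index_uniq ?size_mkseq //; first by lia.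
  by rewrite (perm_uniq ou) enum_uniq.
exists f.
- move=> v w.
  have [i lt_i <-] := ordering_surj v ou; have [j lt_j <-] := ordering_surj w ou.
  have le_i : (i <= #|T|.-1)%N by lia.
  have le_j : (j <= #|T|.-1)%N by lia.
  have := fE _ le_i; have := fE _ le_j.
  have [lt_ij|lt_ji|->] := ltngtP i j; last by rewrite eqxx.
    by have := s_far _ _ lt_ij le_j; lia.
  by have := s_far _ _ lt_ji le_i; rewrite (dist_sym e_sym); lia.
- have f_le v : (f v)%:Z <= LB e.
    have [i lt_i <-] := ordering_surj v ou; have le_i : (i <= #|T|.-1)%N by lia.
    by rewrite fE // -s_last s_mono.
  have LB_ge0 : 0 <= LB e by rewrite -s_last -s0 s_mono.
  suff: (Defs.span f <= `|LB e|)%N by lia.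
  apply/bigmax_leqP => v _; apply/bigmax_leqP => w _.
  by have := f_le v; have := f_le w; lia.
Qed.

End Gaps.

(** * Lower bound block graphs *)

Theorem theorem3p2 (T : finType) (e : rel T)
    (e_sym : symmetric e) (e_irr : irreflexive e)
    (e_block : block_graph e) (e_diam : 2 <= diam e) :
  lower_bound_block_graph e <->
  exists u : nat -> T,
    [/\ ordering u,
        level e (u 0) + level e (u #|T|.-1) = eps e
      & forall i j : nat, i < j -> j <= #|T|.-1 ->
        ((dist e (u i) (u j))%:Z >=
           \sum_(i <= t < j) ((level e (u t))%:Z + (level e (u t.+1))%:Z)
           - (j%:Z - i%:Z) * ((diam e)%:Z + (eps e)%:Z) + (diam e)%:Z + 1)%R].
Proof.
have T_gt1 := diam_gt0_card (ltnW e_diam).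
have [f0 rf0 span_f0] := radio_number_attained e.
split=> [[_ rnE]|[u [ou ends far]]].
  rewrite -span_f0 in rnE.
  have [u [ou ends far]] := tight_labeling_ordering e_sym e_block T_gt1 rf0 rnE.
  exists u; split=> // i j lt_ij le_j.
  by rewrite dist_ge_gap ?(ltnW lt_ij) // far.
split=> //; have [|f rf span_f] := ordering_tight_labeling e_sym (ltnW T_gt1) ou ends.
  by move=> i j lt_ij le_j; rewrite -dist_ge_gap ?(ltnW lt_ij) // far.
have := radio_number_le_span rf.
by have := LB_le_span e_sym e_block T_gt1 rf0; rewrite span_f0; lia.
Qed.
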